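(* Let $A\in\mathbb{R}^{M\times r}$ and $\mathbf{b}\in\mathbb{R}^{M}$ be given, and let $R\in\mathbb{R}^{M\times r'}$ be the random Khatri-Rao matrix described in the context, where $r\le r'\le M$. Assume that $\mathbf{x}\in\mathbb{R}^r$ is the solution that minimizes $\|R^{T}A\hat{\mathbf{x}}-R^{T}\mathbf{b}\|_2$ over $\hat{\mathbf{x}}$ and $\mathbf{y}\in\mathbb{R}^r$ is the solution that minimizes $\|A\hat{\mathbf{y}}-\mathbf{b}\|_2$ over $\hat{\mathbf{y}}$. Let $Q\in\mathbb{R}^{M\times r_Q}$, $r_Q\le r+1$, be the matrix with orthonormal columns from the QR factorization of the augmented matrix $[A\,|\,\mathbf{b}]$, and assume that $R^TQ$ has full rank (in the sense that $(R^TQ)^T(R^TQ)$ is invertible). Then for every $t\ge 0$, with probability at least $1-2\exp(-ct^2)$, $$\|A\mathbf{x}-\mathbf{b}\|_2\le\frac{1+C\sqrt{(r+1)/r'}+t/\sqrt{r'}}{1-C\sqrt{(r+1)/r'}-t/\sqrt{r'}}\,\|A\mathbf{y}-\mathbf{b}\|_2 ,$$ where $C=C_K$ and $c=c_K>0$ depend only on the sub-Gaussian norm $K=\max_{i}\|R(:,i)^{T}Q\|_{\psi_2}$.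
   Context: Random matrix $R$: fix $d\ge 2$, $k\in\{1,\dots,d\}$ and positive integers $M_i$ ($i\ne k$), and let $M=\prod_{i\neq k}M_i$. For each $i\ne k$ let $R_i\in\mathbb{R}^{M_i\times r'}$ be a random matrix with entries $\pm1$, each with probability $1/2$, all entries of all the $R_i$ being mutually independent. Then $R=R_1\odot\cdots\odot R_{k-1}\odot R_{k+1}\odot\cdots\odot R_d\in\mathbb{R}^{M\times r'}$, where $\odot$ is the Khatri-Rao (column-wise Kronecker) product: the $l$-th column is $R(:,l)=\bigotimes_{i\ne k}R_i(:,l)$. QR factorization: $[A\,|\,\mathbf{b}]=QT$ with $Q\in\mathbb{R}^{M\times r_Q}$ having orthonormal columns and $T\in\mathbb{R}^{r_Q\times(r+1)}$. Sub-Gaussian norm: for a real random variable $X$, $\|X\|_{\psi_2}=\sup_{p\ge1}p^{-1/2}(\mathbb{E}|X|^p)^{1/p}$, and $X$ is sub-Gaussian if this is finite. A random vector $X\in\mathbb{R}^n$ is sub-Gaussian if $\langle X,\mathbf{x}\rangle$ is sub-Gaussian for all $\mathbf{x}\in\mathbb{R}^n$, and $\|X\|_{\psi_2}=\sup_{\|\mathbf{x}\|_2=1}\|\langle X,\mathbf{x}\rangle\|_{\psi_2}$.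
   Formalization: The bound is stated only when the denominator 1 - C sqrt((r+1)/r') - t/sqrt(r') is positive; for larger t the right-hand side is negative or undefined and the claim fails. Full rank of R^T Q is read as conditioning on that event. *)

(* Defs.v *)
From HB Require Import structures.
From mathcomp Require Export all_boot all_order all_algebra.
From mathcomp Require Export all_classical all_reals all_analysis.

Set Implicit Arguments.
Unset Strict Implicit.
Unset Printing Implicit Defensive.
Import Order.TTheory GRing.Theory Num.Theory.
Import numFieldNormedType.Exports.

Local Open Scope classical_set_scope.
Local Open Scope ring_scope.

(* The norm `|v| that the library puts on matrices is the sup norm, hence a
   separate Euclidean norm. *)
Definition l2norm (R : realType) (n : nat) (v : 'cV[R]_n) : R :=
  Num.sqrt (\sum_i v i 0 ^+ 2).

Definition lsq_solution (R : realType) (m n : nat)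
    (A : 'M[R]_(m, n)) (b : 'cV[R]_m) (x : 'cV[R]_n) : Prop :=
  forall z : 'cV[R]_n, l2norm (A *m x - b) <= l2norm (A *m z - b).

(* Row indices of a Kronecker product of matrices with m i rows
   (0 <= i < d, i != k) are mixed-radix numerals whose digits are the row
   indices of the factors, the first factor being the most significant. *)
Section KhatriRao.
Context (d : nat) (k : 'I_d) (m : {i : 'I_d | i != k} -> nat).

Definition stride (i : {i : 'I_d | i != k}) : nat :=
  (\prod_(j : {i : 'I_d | i != k} | (val i < val j)%N) m j)%N.

Lemma digit_subproof (i : {i : 'I_d | i != k}) (a : 'I_(\prod_j m j)%N) :
  ((a %/ stride i) %% m i < m i)%N.
Proof.
rewrite ltn_mod lt0n; apply/eqP => mi0.
have := leq_ltn_trans (leq0n a) (ltn_ord a).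
by rewrite (bigD1 i) //= mi0 mul0n.
Qed.

Definition digit (i : {i : 'I_d | i != k}) (a : 'I_(\prod_j m j)%N) : 'I_(m i) :=
  Ordinal (digit_subproof i a).

Definition khatri_rao (R : realType) (n : nat)
    (B : forall i, 'M[R]_(m i, n)) : 'M[R]_((\prod_j m j)%N, n) :=
  \matrix_(a, l) \prod_i B i (digit i a) l.
End KhatriRao.

Section Probability.
Context (disp : measure_display) (Omega : measurableType disp) (R : realType)
        (P : probability Omega R).

(* Values other than 1 and -1 are excluded surely, not just almost surely. *)
Definition rademacher (X : {RV P >-> R}) : Prop :=
  [/\ forall w, X w = 1 \/ X w = -1,
      P (X @^-1` [set 1]) = (2^-1)%:E
    & P (X @^-1` [set -1]) = (2^-1)%:E].

Definition mutually_independent (I : finType) (X : I -> {RV P >-> R}) : Prop :=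
  forall (J : {set I}) (B : I -> set R), (forall i, measurable (B i)) ->
    P [set w | forall i, i \in J -> B i (X i w)] =
      (\prod_(i in J) P (X i @^-1` B i))%E.

Definition psi2 (X : Omega -> R) : \bar R :=
  ereal_sup [set ((p `^ (- 2^-1))%:E * 'N[P]_(p%:E)[EFin \o X])%E
            | p in [set p : R | 1 <= p]].

Definition psi2_vec (n : nat) (X : Omega -> 'rV[R]_n) : \bar R :=
  ereal_sup [set psi2 (fun w => (X w *m x) 0 0)
            | x in [set x : 'cV[R]_n | l2norm x = 1]].

Definition random_khatri_rao (d : nat) (k : 'I_d)
    (m : {i : 'I_d | i != k} -> nat) (n : nat)
    (X : forall i, 'I_(m i) -> 'I_n -> {RV P >-> R}) (w : Omega) :
    'M[R]_((\prod_j m j)%N, n) :=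
  khatri_rao (fun i => \matrix_(a, l) X i a l w).
End Probability.

(* Main.v *)
From mathcomp Require Import ring lra measurable_realfun.
Require Import Defs.
Import Order.TTheory GRing.Theory Num.Theory.
Import numFieldNormedType.Exports.

Set Implicit Arguments.
Unset Strict Implicit.
Unset Printing Implicit Defensive.

Local Open Scope classical_set_scope.
Local Open Scope ring_scope.

(** All residuals [A z - b] lie in the range of [Q], so the theorem follows once
    [v |-> |R^T Q v|^2 / r'] is within a factor [1 - rho] and [1 + rho] of [|v|^2]
    for every [v]: then [R^T Q] is injective, and comparing the residuals of [x]
    and [y] before and after the sketch gives the bound ([sketched_lsq]). It
    remains to show that this near-isometry fails with probability at most
    [2 exp (- c t^2)]. Since near-isometry implies full rank, no conditioning is
    left to handle: the event of full rank and small residual contains the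
    near-isometry event.

    The matrix [R] is a function of finitely many independent signs, hence of a
    uniformly distributed pattern of signs ([sign_pattern_uniform]), and all
    probabilities and moments become averages over a finite type of functions
    from columns to column patterns, where independence of the columns is the
    product formula [mean_prod]. The rows of [R^T Q] are isotropic, because the
    product of the entries of a Khatri-Rao column in two different rows is odd in
    some sign ([mean_kr_entry], which rests on mixed-radix numerals being
    determined by their digits), and their sub-Gaussian norm bounds the moments
    ([psi2_moments]).

    For a fixed [v] of norm [1] the squares of the coordinates of [R^T Q v] are
    independent, have mean [1] and moments growing at most like [(2 K^2 q)^q].
    So their Laplace transform is finite near [0] ([mean_expR_le2]) and, after
    centring, quadratic there ([mean_expR_centred]); Chernoff's method then gives
    a Gaussian tail for the deviation of their sum ([freq_dot_dev]).

    The step from fixed vectors to all vectors is a union bound over at most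
    [16^n] points of the integer lattice. Instead of approximating a point of the
    sphere by a net and absorbing the error in the operator norm, a point [x] of
    square norm [n] is rounded to the lattice coordinate by coordinate: a
    quadratic form corrected by its diagonal part is affine in every coordinate,
    so that some rounding does not decrease its absolute value ([qform_net]). The
    summand [C sqrt ((r + 1) / r')] of [rho] absorbs the factor [16^n], and the
    summand [t / sqrt r'] yields the tail ([net_union_bound]). *)

(** * Averages over finite types *)

Section Mean.
Context (R : realType).

Definition mean (T : finType) (f : T -> R) : R := #|T|%:R^-1 * \sum_x f x.

Context (T : finType).
Implicit Types f g : T -> R.

Lemma eq_mean f g : f =1 g -> mean f = mean g.
Proof. by move=> fg; rewrite /mean (eq_bigr g). Qed.

Lemma ler_mean f g : (forall x, f x <= g x) -> mean f <= mean g.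
Proof.
by move=> fg; rewrite ler_wpM2l ?invr_ge0// ler_sum// => x _; exact: fg.
Qed.

Lemma mean_ge0 f : (forall x, 0 <= f x) -> 0 <= mean f.
Proof. by move=> f0; rewrite mulr_ge0 ?invr_ge0// sumr_ge0. Qed.

Lemma meanD f g : mean (fun x => f x + g x) = mean f + mean g.
Proof. by rewrite /mean big_split mulrDr. Qed.

Lemma meanZ a f : mean (fun x => a * f x) = a * mean f.
Proof. by rewrite /mean -mulr_sumr mulrCA. Qed.

Lemma mean_sum (I : finType) (P : pred I) (F : I -> T -> R) :
  mean (fun x => \sum_(i | P i) F i x) = \sum_(i | P i) mean (F i).
Proof. by rewrite /mean exchange_big mulr_sumr. Qed.

Lemma mean_cst a : (0 < #|T|)%N -> mean ((fun=> a) : T -> R) = a.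
Proof.
move=> T0; rewrite /mean sumr_const -[a *+ _]mulr_natl mulrA mulVf ?mul1r//.
by rewrite pnatr_eq0 -lt0n.
Qed.

(** An involution that changes the sign of [f] pairs off its values. *)
Lemma mean_odd f (s : T -> T) :
  involutive s -> (forall x, f (s x) = - f x) -> mean f = 0.
Proof.
move=> sK fs; have : \sum_x f x = - \sum_x f x.
  rewrite [LHS](reindex s) -?sumrN; last by exists s => x _; exact: sK.
  by apply: eq_bigr => x _; rewrite fs.
by move=> /eqP; rewrite -addr_eq0 -mulr2n mulrn_eq0 /= /mean => /eqP ->;
   rewrite mulr0.
Qed.

End Mean.

(** Under the uniform distribution on a space of functions the coordinates are
    independent: this is where products over the sample come from. *)
Lemma mean_prod (R : realType) (I T : finType) (f : I -> T -> R) :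
  mean (fun u : {ffun I -> T} => \prod_i f i (u i)) = \prod_i mean (f i).
Proof.
rewrite /mean big_split/= bigA_distr_bigA card_ffun prodr_const natrX.
by rewrite exprVn.
Qed.

Lemma mean_coord (R : realType) (I T : finType) (i : I) (f : T -> R) :
  (0 < #|T|)%N -> mean (fun u : {ffun I -> T} => f (u i)) = mean f.
Proof.
move=> T0; pose F j : T -> R := if j == i then f else fun=> 1.
rewrite (@eq_mean _ _ _ (fun u : {ffun I -> T} => \prod_j F j (u j))).
  rewrite mean_prod (bigD1 i)//= big1 => [|j ji].
    by rewrite mulr1 /F eqxx.
  by rewrite /F (negbTE ji) mean_cst.
move=> u; rewrite (bigD1 i)//= big1 => [|j ji]; first by rewrite mulr1 /F eqxx.
by rewrite /F (negbTE ji).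
Qed.

Definition freq (R : realType) (T : finType) (E : {pred T}) : R :=
  mean (fun x => (x \in E)%:R).

Lemma ler_freq (R : realType) (T : finType) (E F : {pred T}) :
  {subset E <= F} -> freq R E <= freq R F.
Proof.
move=> EF; apply: ler_mean => x; rewrite ler_nat.
by case: (boolP (x \in E)) => // /EF ->.
Qed.

Lemma freq_exists (R : realType) (T I : finType) (A : {pred I})
    (E : I -> {pred T}) (b : R) :
  (forall i, i \in A -> freq R (E i) <= b) ->
  freq R [pred x | [exists i in A, x \in E i]] <= #|A|%:R * b.
Proof.
move=> Eb; apply: (@le_trans _ _ (\sum_(i in A) freq R (E i))).
  rewrite -mean_sum; apply: ler_mean => x; rewrite inE.
  have s0 : 0 <= \sum_(i in A) (x \in E i)%:R :> R by apply: sumr_ge0.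
  case: (boolP [exists i in A, x \in E i]) => // /exists_inP[i iA xE].
  by rewrite (bigD1 i)//= xE lerDl sumr_ge0.
rewrite mulr_natl -sumr_const; exact: ler_sum.
Qed.

(** * Exponential moments *)

Section ExpMoments.
Context (R : realType).
Implicit Types y a l : R.

Lemma expR_sub1_le y : expR y - 1 <= y * expR y.
Proof.
have := ler_wpM2l (expR_ge0 y) (expR_ge1Dx (- y)).
rewrite expRxMexpNx_1; lra.
Qed.

(** Using the first-order bound twice gives a quadratic remainder. *)
Lemma expR_le_quad y : expR y <= 1 + y + y ^+ 2 * expR `|y|.
Proof.
have h := expR_sub1_le y; have h1 := expR_ge1Dx y.
have [y0|y0] := leP 0 y.
  rewrite ger0_norm//.
  have := ler_wpM2l y0 h; rewrite expr2; lra.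
rewrite ltr0_norm//.
have e1 : 1 <= expR (- y) by have := expR_ge1Dx (- y); lra.
have y2 : 0 <= y ^+ 2 by rewrite sqr_ge0.
have : y ^+ 2 * 1 <= y ^+ 2 * expR (- y) by rewrite ler_wpM2l.
have : (- y) * (1 - expR y) <= (- y) * (- y) by rewrite ler_wpM2l; lra.
rewrite expr2; lra.
Qed.

Lemma sqr_le_expR y : 0 <= y -> y ^+ 2 <= 4 * expR y.
Proof.
move=> y0; have -> : expR y = expR (y / 2) ^+ 2.
  by rewrite -expRM_natl; congr expR; field.
have h : y / 2 <= expR (y / 2) by have := expR_ge1Dx (y / 2); lra.
have : (y / 2) ^+ 2 <= expR (y / 2) ^+ 2.
  by rewrite lerXn2r// nnegrE ?expR_ge0//; lra.
by rewrite expr_div_n; lra.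
Qed.

(** One term of the exponential series at [q]: Stirling's lower bound. *)
Lemma expn_self_le q : (q ^ q)%:R <= expR 1 ^+ q * (q`!)%:R :> R.
Proof.
case: q => [|q]; first by rewrite expr0 mul1r.
rewrite natrX -expRM_natl mulr1 -ler_pdivrMr ?ltr0n ?fact_gt0//.
by apply: le_trans (expR_ge1Dxn q _); rewrite ?lerDr.
Qed.

Lemma sum_half_le2 n : \sum_(i < n) 2^-1 ^+ i <= 2 :> R.
Proof.
have -> : \sum_(i < n) 2^-1 ^+ i = 2 - 2 * 2^-1 ^+ n :> R.
  elim: n => [|n IH]; first by rewrite big_ord0 expr0; lra.
  by rewrite big_ord_recr /= IH exprS; lra.
by rewrite lerBlDr lerDl mulr_ge0// exprn_ge0.
Qed.

(** Moments growing like [q ^ q] make the exponential series converge like a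
    geometric one. *)
Lemma mean_expR_le2 (T : finType) (Z : T -> R) a l :
  0 <= l -> 2 * (expR 1 * (a * l)) <= 1 ->
  (forall x, 0 <= Z x) ->
  (forall q : nat, mean (fun x => Z x ^+ q) <= (a * q%:R) ^+ q) ->
  0 <= a ->
  mean (fun x => expR (l * Z x)) <= 2.
Proof.
move=> l0 al Z0 mom a0.
pose S n := mean (fun x => series (exp_coeff (l * Z x)) n).
have cvgS : S @ \oo --> mean (fun x => expR (l * Z x)).
  rewrite /S /mean; apply: cvgMl_tmp.
  apply: (@cvg_big _ _ _ _ xpredT add_continuous _ _ _
    (fun x n => series (exp_coeff (l * Z x)) n) (fun x => expR (l * Z x))) => x _.
  exact: is_cvg_series_exp_coeff.
rewrite -(cvg_lim _ cvgS)//; apply: limr_le.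
  by apply/cvg_ex; eexists; exact: cvgS.
apply: nearW => n; rewrite /S.
apply: le_trans (sum_half_le2 n).
rewrite (@eq_mean _ _ _ (fun x => \sum_(i < n) (l ^+ i / i`!%:R) * Z x ^+ i));
  last first.
  move=> x; rewrite seriesEord; apply: eq_bigr => i _.
  by rewrite /exp_coeff /= exprMn mulrAC.
rewrite mean_sum; apply: ler_sum => i _; rewrite meanZ.
apply: (@le_trans _ _ ((expR 1 * (a * l)) ^+ i)).
  apply: (@le_trans _ _ (l ^+ i / i`!%:R * (a * i%:R) ^+ i)).
    by rewrite ler_wpM2l// divr_ge0// exprn_ge0.
  rewrite !exprMn -natrX mulrAC ler_pdivrMr ?ltr0n ?fact_gt0//.
  have := ler_wpM2l (_ : 0 <= a ^+ i * l ^+ i) (expn_self_le i).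
  by rewrite mulr_ge0 ?exprn_ge0// => /(_ isT); lra.
apply: lerXn2r; rewrite ?nnegrE ?mulr_ge0 ?expR_ge0//; lra.
Qed.

(** The first-order term of [expR (l * (Z - 1))] vanishes on average, so the
    logarithm of the Laplace transform is quadratic near [0]. *)
Lemma mean_expR_centred (T : finType) (Z : T -> R) l0 l :
  (0 < #|T|)%N -> 0 < l0 -> (forall x, 0 <= Z x) -> mean Z = 1 ->
  mean (fun x => expR (l0 * Z x)) <= 2 -> 2 * `|l| <= l0 ->
  mean (fun x => expR (l * (Z x - 1))) <= expR (32 / l0 ^+ 2 * l ^+ 2).
Proof.
move=> T0 l00 Z0 Z1 mgf ll0.
have Zexp x : expR (l * Z x) <=
    1 + l * Z x + l ^+ 2 * (16 / l0 ^+ 2) * expR (l0 * Z x).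
  apply: le_trans (expR_le_quad _) _; rewrite lerD2l exprMn.
  (* Half of the exponential moment absorbs [Z x ^+ 2], half [expR `|l * Z x|]. *)
  rewrite -(mulrA (l ^+ 2)) -(mulrA (l ^+ 2)) ler_wpM2l ?sqr_ge0//.
  have -> : Z x ^+ 2 = (l0 / 2 * Z x) ^+ 2 * (4 / l0 ^+ 2).
    by field; rewrite gt_eqF.
  have h0 : 0 <= l0 / 2 * Z x by rewrite mulr_ge0//; lra.
  have -> : l0 * Z x = l0 / 2 * Z x + l0 / 2 * Z x by field.
  rewrite expRD.
  have e1 : expR `|l * Z x| <= expR (l0 / 2 * Z x).
    rewrite ler_expR normrM (ger0_norm (Z0 x)) ler_wpM2r//; lra.
  have := ler_pM (sqr_ge0 _) (expR_ge0 _) (sqr_le_expR h0) e1.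
  have l4 : 0 <= 4 / l0 ^+ 2 by rewrite divr_ge0// sqr_ge0.
  by move=> /(ler_wpM2l l4); lra.
have : mean (fun x => expR (l * Z x)) <= 1 + l + 32 / l0 ^+ 2 * l ^+ 2.
  apply: le_trans (ler_mean Zexp) _; rewrite !meanD meanZ meanZ mean_cst// Z1.
  have l16 : 0 <= l ^+ 2 * (16 / l0 ^+ 2).
    by rewrite mulr_ge0 ?divr_ge0 ?sqr_ge0.
  by have := ler_wpM2l l16 mgf; lra.
rewrite (@eq_mean _ _ (fun x => expR (l * (Z x - 1)))
  (fun x => expR (- l) * expR (l * Z x))); last first.
  by move=> x; rewrite -expRD; congr expR; ring.
rewrite meanZ => h.
have -> : 32 / l0 ^+ 2 * l ^+ 2 = - l + (l + 32 / l0 ^+ 2 * l ^+ 2) by ring.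
rewrite expRD ler_wpM2l ?expR_ge0//; apply: le_trans h _.
by rewrite -addrA expR_ge1Dx.
Qed.

End ExpMoments.

(** * Tails of independent sums *)

Section Tails.
Context (R : realType) (I T : finType).
Implicit Types (Z : T -> R) (a b c l V : R).

Lemma freq_sum_ge Z a l :
  0 < l ->
  freq R [pred u : {ffun I -> T} | a <= \sum_i Z (u i)]
    <= expR (- (l * a)) * mean (fun x => expR (l * Z x)) ^+ #|I|.
Proof.
move=> l0.
have -> : mean (fun x => expR (l * Z x)) ^+ #|I| =
    mean (fun u : {ffun I -> T} => \prod_i expR (l * Z (u i))).
  by rewrite (mean_prod (fun _ x => expR (l * Z x))) prodr_const.
rewrite -meanZ; apply: ler_mean => u; rewrite -expR_sum -expRD -mulr_sumr inE.
case: (leP a) => h; last exact: expR_ge0.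
have -> : 1%:R = expR 0 :> R by rewrite expR0.
by rewrite ler_expR addrC -mulrBr mulr_ge0 ?subr_ge0// ltW.
Qed.

(** Chernoff's method on both sides, at the minimizer [l = c / (2 V)] of
    [V l ^ 2 - l c]. *)
Lemma freq_sum_dev Z V c :
  0 < V -> 0 < c ->
  (forall l, `|l| <= c / (2 * V) ->
     mean (fun x => expR (l * Z x)) <= expR (V * l ^+ 2)) ->
  freq R [pred u : {ffun I -> T} | #|I|%:R * c <= `|\sum_i Z (u i)|]
    <= 2 * expR (- (#|I|%:R * c ^+ 2 / (4 * V))).
Proof.
move=> V0 c0 mgf; set l := c / (2 * V) in mgf *.
have l0 : 0 < l by rewrite divr_gt0// mulr_gt0.
have tail (W : T -> R) :
    mean (fun x => expR (l * W x)) <= expR (V * l ^+ 2) ->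
    freq R [pred u : {ffun I -> T} | #|I|%:R * c <= \sum_i W (u i)]
      <= expR (- (#|I|%:R * c ^+ 2 / (4 * V))).
  move=> mW; apply: le_trans (freq_sum_ge _ _ l0) _.
  have m0 : 0 <= mean (fun x => expR (l * W x)).
    by apply: mean_ge0 => x; exact: expR_ge0.
  apply: (@le_trans _ _ (expR (- (l * (#|I|%:R * c))) *
                         expR (V * l ^+ 2) ^+ #|I|)).
    by rewrite ler_wpM2l ?expR_ge0// lerXn2r// nnegrE ?expR_ge0.
  rewrite -expRM_natl -expRD ler_expR /l le_eqVlt; apply/orP; left; apply/eqP.
  by field; rewrite gt_eqF.
rewrite [2 * _]mulr_natl mulr2n.
have := tail Z; rewrite mgf ?gtr0_norm// => /(_ isT) t1.
have := tail (fun x => - Z x).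
rewrite (@eq_mean _ _ _ (fun x => expR (- l * Z x))); last first.
  by move=> x; rewrite mulNr mulrN.
have := mgf (- l); rewrite sqrrN normrN gtr0_norm// lexx => -> // /(_ isT) t2.
apply: le_trans (lerD t1 t2); rewrite -meanD; apply: ler_mean => u.
rewrite !inE sumrN ler_normr -natrD ler_nat.
by do 2!case: (_ <= _).
Qed.

End Tails.

(** * Quadratic forms on the integer lattice *)

Section Rounding.
Context (R : realType) (n : nat).
Implicit Types (z v : 'I_n -> R) (h : ('I_n -> R) -> R) (i : 'I_n).

Definition upd z i (a : R) : 'I_n -> R := fun j => if j == i then a else z j.

Definition affine_at h i : Prop := forall z (p a b : R),
  h (upd z i ((1 - p) * a + p * b)) =
  (1 - p) * h (upd z i a) + p * h (upd z i b).

Lemma affine_at_sum (I : finType) (H : I -> ('I_n -> R) -> R) i :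
  (forall j, affine_at (H j) i) -> affine_at (fun z => \sum_j H j z) i.
Proof.
move=> aH z p a b; rewrite (eq_bigr _ (fun j _ => aH j z p a b)).
by rewrite big_split -!mulr_sumr.
Qed.

(** In each coordinate in turn, an affine function is at least as large in
    absolute value at one of the two ends as in between. *)
Lemma multiaffine_rounding h (lo hi p : 'I_n -> R) :
  (forall i, affine_at h i) -> (forall i, 0 <= p i <= 1) ->
  exists2 v, forall i, v i = lo i \/ v i = hi i &
    `|h (fun i => (1 - p i) * lo i + p i * hi i)| <= `|h v|.
Proof.
move=> ah p01; set x := fun i => _.
suff [v [v1 v2 v3]] : exists v,
    [/\ forall i, i \in enum 'I_n -> v i = lo i \/ v i = hi i,
        forall i, i \notin enum 'I_n -> v i = x i & `|h x| <= `|h v|].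
  by exists v => // i; apply: v1; rewrite mem_enum.
elim: (enum _) => [|i s [v [v1 v2 v3]]]; first by exists x.
case: (boolP (i \in s)) => [is_|nis].
  exists v; split => // j; rewrite inE; first by case/predU1P => [->|]; exact: v1.
  by rewrite negb_or => /andP[_]; exact: v2.
have vE : v = upd v i ((1 - p i) * lo i + p i * hi i).
  by apply/funext => j; rewrite /upd; case: eqP => // ->; rewrite v2.
have mk a : a = lo i \/ a = hi i -> `|h v| <= `|h (upd v i a)| ->
    exists v, [/\ forall j, j \in i :: s -> v j = lo j \/ v j = hi j,
        forall j, j \notin i :: s -> v j = x j & `|h x| <= `|h v|].
  move=> ia hv; exists (upd v i a); split.
  - move=> j; rewrite inE /upd; case: eqP => [->//|_ /=]; exact: v1.
  - by move=> j; rewrite inE negb_or /upd => /andP[/negbTE -> /v2].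
  - exact: le_trans v3 hv.
have /andP[p0 p1] := p01 i.
have hv : `|h v| <= (1 - p i) * `|h (upd v i (lo i))| +
                     p i * `|h (upd v i (hi i))|.
  rewrite {1}vE ah; apply: le_trans (ler_normD _ _) _.
  by rewrite !normrM (ger0_norm p0) ger0_norm ?subr_ge0.
have [le|/ltW le] := leP `|h (upd v i (lo i))| `|h (upd v i (hi i))|.
  apply: (mk (hi i)); first by right.
  apply: le_trans hv _; have := ler_wpM2l (_ : 0 <= 1 - p i) le.
  by rewrite subr_ge0 => /(_ p1); lra.
apply: (mk (lo i)); first by left.
by apply: le_trans hv _; have := ler_wpM2l p0 le; lra.
Qed.

End Rounding.

Section LatticeNet.
Context (R : realType) (n : nat).
Implicit Types (x : 'I_n -> R) (M : 'M[R]_n).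

Definition qform M x : R := \sum_i \sum_j M i j * x i * x j.

Definition sqnorm x : R := \sum_i x i ^+ 2.

Lemma qformZ M x a : qform M (fun i => a * x i) = a ^+ 2 * qform M x.
Proof.
rewrite /qform mulr_sumr; apply: eq_bigr => i _; rewrite mulr_sumr.
by apply: eq_bigr => j _; ring.
Qed.

Lemma sqnormZ x a : sqnorm (fun i => a * x i) = a ^+ 2 * sqnorm x.
Proof.
by rewrite /sqnorm mulr_sumr; apply: eq_bigr => i _; rewrite exprMn.
Qed.

Lemma sqnorm_ge0 x : 0 <= sqnorm x.
Proof. by apply: sumr_ge0 => i _; exact: sqr_ge0. Qed.

Lemma sqnorm_eq0 x : sqnorm x = 0 -> forall i, x i = 0.
Proof.
move=> /eqP; rewrite psumr_eq0 => [/allP h i|i _]; last exact: sqr_ge0.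
by have := h i; rewrite mem_index_enum sqrf_eq0 => /(_ isT)/eqP.
Qed.

(** Coordinates are pairs of a sign and an absolute value. *)
Definition lattice : finType := {ffun 'I_n -> bool * 'I_(2 * n).+1}.

Definition lvec (w : lattice) (i : 'I_n) : R := (-1) ^+ (w i).1 * (w i).2%:R.

(** Rounding a vector of square norm [n] by at most [1] in each coordinate
    leaves an [l1]-norm of at most [2 n]. *)
Definition net : {set lattice} :=
  [set w : lattice | (\sum_i (w i).2 <= 2 * n)%N].

(** Weighing each coordinate [k] by [2 ^ -|k|] makes the count a product of
    geometric sums. *)
Lemma card_net : (#|net|%:R : R) <= 16 ^+ n.
Proof.
have one (w : lattice) : w \in net ->
    1 <= 4 ^+ n * \prod_i 2^-1 ^+ (w i).2 :> R.
  rewrite inE => wn; rewrite prodrXr.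
  have -> : 4 = 2 ^+ 2 :> R by ring.
  rewrite -exprM exprVn -ler_pdivrMr ?invr_gt0 ?exprn_gt0// div1r invrK.
  by rewrite ler_weXn2l// ler1n.
rewrite -sumr_const.
apply: (@le_trans _ _ (\sum_(w in net) 4 ^+ n * \prod_i 2^-1 ^+ (w i).2)).
  exact: ler_sum.
apply: (@le_trans _ _ (\sum_(w : lattice) 4 ^+ n * \prod_i 2^-1 ^+ (w i).2)).
  rewrite [leRHS](bigID (mem net))/= lerDl sumr_ge0// => w _.
  by rewrite mulr_ge0 ?exprn_ge0// prodr_ge0// => i _; rewrite exprn_ge0.
rewrite -mulr_sumr; have -> : 16 = 4 * 4 :> R by ring.
rewrite exprMn ler_wpM2l ?exprn_ge0//.
rewrite -(bigA_distr_bigA (fun _ (k : bool * 'I_(2 * n).+1) => 2^-1 ^+ k.2 : R)).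
rewrite prodr_const card_ord; apply: lerXn2r; rewrite ?nnegrE//.
  by apply: sumr_ge0 => k _; rewrite exprn_ge0.
rewrite -(pair_bigA _ (fun (b : bool) (k : 'I_(2 * n).+1) => 2^-1 ^+ k : R))/=.
by rewrite sumr_const card_bool mulr2n; have := @sum_half_le2 R (2 * n).+1; lra.
Qed.

(** A function of the form [z] |-> quadratic form minus its diagonal part
    around [x] is affine in each coordinate and agrees with the form at [x]. *)
Lemma affine_qform M x i :
  affine_at (fun z => qform M z - \sum_j M j j * (z j - x j) ^+ 2) i.
Proof.
set h := (fun z => _).
have -> : h = fun z => \sum_a \sum_b
    (if a == b then M a a * (2 * x a * z a - x a ^+ 2)
     else M a b * z a * z b).
  apply/funext => z; rewrite /h /qform -sumrB; apply: eq_bigr => a _.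
  rewrite (bigD1 a)//= [RHS](bigD1 a)//= eqxx addrAC; congr (_ + _).
    by ring.
  by apply: eq_bigr => b ba; rewrite eq_sym (negbTE ba).
apply: affine_at_sum => a; apply: affine_at_sum => b z p u v; rewrite /upd.
case: (a =P b) => [_|ab]; first by case: eqP => _; ring.
case: (a =P i) => [ai|_]; case: (b =P i) => [bi|_]; try ring.
by case: ab; rewrite ai bi.
Qed.

(** A point of square norm [n] is rounded to a lattice point whose coordinates
    differ from its own by at most [1]; the net contains the basis vectors, so
    that the diagonal of the form is under control as well. *)
Lemma qform_net M (d : R) :
  0 <= d ->
  (forall w, w \in net -> `|qform M (lvec w)| <= d * sqnorm (lvec w)) ->
  forall x, `|qform M x| <= 5 * d * sqnorm x.
Proof.
move=> d0 netM.
have diag i : `|M i i| <= d.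
  have n0 : (0 < n)%N by apply: leq_ltn_trans (ltn_ord i).
  have lt1 : (1 < (2 * n).+1)%N by rewrite ltnS muln_gt0.
  pose w : lattice := [ffun j => (false, if j == i then Ordinal lt1 else ord0)].
  have wE j : lvec w j = (j == i)%:R.
    by rewrite /lvec ffunE /= expr0 mul1r; case: eqP.
  have := netM w; rewrite inE (bigD1 i)//= big1 => [|j ji]; last first.
    by rewrite ffunE (negbTE ji).
  rewrite ffunE eqxx addn0 muln_gt0 n0 => /(_ isT).
  have -> : qform M (lvec w) = M i i.
    rewrite /qform (bigD1 i)//= [X in _ + X]big1 => [|j ji]; last first.
      by apply: big1 => k _; rewrite !wE (negbTE ji) mulr0 mul0r.
    rewrite (bigD1 i)//= big1 => [|k ki]; last by rewrite !wE (negbTE ki) mulr0.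
    by rewrite !wE eqxx !mulr1 !addr0.
  have -> : sqnorm (lvec w) = 1.
    rewrite /sqnorm (bigD1 i)//= big1 => [|j ji]; last first.
      by rewrite wE (negbTE ji) expr0n.
    by rewrite wE eqxx expr1n addr0.
  by rewrite mulr1.
suff scaled x : sqnorm x = n%:R -> `|qform M x| <= 5 * d * n%:R.
  move=> x; have [x0|x0] := eqVneq (sqnorm x) 0.
    rewrite x0 mulr0 normr_le0; apply/eqP/big1 => i _; apply: big1 => j _.
    by rewrite (sqnorm_eq0 x0 i) mulr0 mul0r.
  have sx0 : 0 < sqnorm x by rewrite lt_neqAle eq_sym x0 sqnorm_ge0.
  have n0 : (0 < n)%N.
    case: (posnP n) => // n0; move: sx0; rewrite /sqnorm big1 ?ltxx// => i.
    by have := ltn_ord i; rewrite {2}n0.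
  pose a := Num.sqrt (n%:R / sqnorm x).
  have a2 : a ^+ 2 = n%:R / sqnorm x by rewrite sqr_sqrtr// divr_ge0// ltW.
  have a20 : 0 < a ^+ 2 by rewrite a2 divr_gt0// ltr0n.
  have nE : n%:R = a ^+ 2 * sqnorm x by rewrite a2 divfK.
  have := scaled (fun i => a * x i); rewrite sqnormZ -nE => /(_ erefl).
  by rewrite qformZ normrM (ger0_norm (ltW a20)) nE mulrCA ler_pM2l.
move=> xn.
pose k i := Num.truncn `|x i|.
pose p i : R := `|x i| - (k i)%:R.
have ki i : (k i)%:R <= `|x i| < (k i).+1%:R by rewrite truncn_itv.
have p01 i : 0 <= p i <= 1.
  by have := ki i; rewrite /p -natr1; lra.
pose sg i : R := (-1) ^+ (x i < 0)%R.
have sg2 i : sg i ^+ 2 = 1 by rewrite /sg sqrr_sign.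
have sgx i : x i = sg i * `|x i| by rewrite /sg -numEsign.
pose lo i := sg i * (k i)%:R; pose hi i := sg i * (k i).+1%:R.
have [v vlohi] := multiaffine_rounding (h := fun z =>
  qform M z - \sum_j M j j * (z j - x j) ^+ 2) lo hi (affine_qform M x) p01.
have xE i : (1 - p i) * lo i + p i * hi i = x i.
  by rewrite [RHS]sgx /lo /hi /p -natr1; ring.
rewrite (funext xE) [X in `|_ - X| <= _ -> _]big1 => [|j _]; last first.
  by rewrite xE subrr expr0n mulr0.
rewrite subr0 => le; apply: (le_trans le) => {le}.
have vlo i : v i = sg i * (k i)%:R \/ v i = sg i * (k i).+1%:R := vlohi i.
have nx : \sum_i `|x i| <= n%:R.
  have -> : n%:R = \sum_i (x i ^+ 2 + 1) / 2.
    rewrite -mulr_suml big_split /= sumr_const card_ord.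
    by rewrite [\sum_i _]xn; lra.
  apply: ler_sum => i _; have := sqr_ge0 (`|x i| - 1).
  by rewrite sqrrB1 real_normK ?num_real//; lra.
(* [m i] is the absolute value of the rounded coordinate. *)
pose m i : nat := if v i == lo i then k i else (k i).+1.
have vm i : v i = sg i * (m i)%:R.
  rewrite /m; case: eqP => [//|vi].
  by case: (vlo i).
have mx i : (m i)%:R <= `|x i| + 1.
  by have := ki i; rewrite /m; case: ifP; rewrite -natr1; lra.
have sum_m : (\sum_i m i <= 2 * n)%N.
  rewrite -(ler_nat R) natr_sum natrM.
  apply: (@le_trans _ _ (\sum_i (`|x i| + 1))); first exact: ler_sum.
  by rewrite big_split /= sumr_const card_ord; lra.
have m2n i : (m i < (2 * n).+1)%N.
  by rewrite ltnS (leq_trans _ sum_m)// (bigD1 i)//= leq_addr.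
pose w : lattice := [ffun i => (x i < 0, Ordinal (m2n i))].
have vw : v = lvec w by apply/funext => i; rewrite vm /lvec ffunE.
have wnet : w \in net.
  by rewrite inE (eq_bigr m)// => i _; rewrite ffunE.
have v4 : sqnorm v <= 4 * n%:R.
  apply: (@le_trans _ _ (\sum_i (x i ^+ 2 + 2 * `|x i| + 1))).
    apply: ler_sum => i _; rewrite vm exprMn sg2 mul1r.
    have -> : x i ^+ 2 + 2 * `|x i| + 1 = (`|x i| + 1) ^+ 2.
      by rewrite -[x i ^+ 2]real_normK ?num_real//; ring.
    by apply: lerXn2r; rewrite ?nnegrE ?ler0n ?mx// addr_ge0.
  rewrite !big_split /= -mulr_sumr sumr_const card_ord [\sum_i x i ^+ 2]xn; lra.
apply: le_trans (ler_normB _ _) _.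
have h1 : `|qform M v| <= d * (4 * n%:R).
  by rewrite vw; apply: le_trans (netM w wnet) _; rewrite -vw ler_wpM2l.
have h2 : `|\sum_j M j j * (v j - x j) ^+ 2| <= d * n%:R.
  apply: le_trans (ler_norm_sum _ _ _) _.
  rewrite mulr_natr -[n in d *+ n]card_ord -sumr_const; apply: ler_sum => i _.
  rewrite normrM -[d]mulr1 ler_pM//.
  rewrite sgx vm -mulrBr exprMn sg2 mul1r normrX.
  rewrite expr_le1//; have := ki i; rewrite /m ler_norml -natr1.
  by case: ifP => _; rewrite -?natr1; lra.
lra.
Qed.

End LatticeNet.

(** * Deviation of random Gram matrices *)

Section Constants.
Context (R : realType).
Implicit Types K : R.

(** The exponential moment of order [mgf_radius K] of the square of a variable
    of sub-Gaussian norm [K] is bounded by an absolute constant. *)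
Definition mgf_radius K : R := (4 * expR 1 * (1 + K ^+ 2))^-1.

(** The coefficient in [mean_expR_centred] for the radius [mgf_radius K]. *)
Definition mgf_var K : R := 32 / mgf_radius K ^+ 2.

Lemma mgf_radius_gt0 K : 0 < mgf_radius K.
Proof.
rewrite invr_gt0 !mulr_gt0 ?expR_gt0//.
by have := sqr_ge0 K; lra.
Qed.

Lemma mgf_var_gt0 K : 0 < mgf_var K.
Proof. by rewrite divr_gt0// exprn_gt0// mgf_radius_gt0. Qed.

Lemma mgf_radius_le1 K : mgf_radius K <= 1.
Proof.
have k1 : 1 <= 1 + K ^+ 2 by have := sqr_ge0 K; lra.
have e1 : 1 <= 4 * expR 1 :> R by have := @expR_ge1Dx R 1; lra.
have x1 := mulr_ege1 e1 k1.
by rewrite invf_le1// (lt_le_trans ltr01 x1).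
Qed.

Lemma mgf_radius_small K : 2 * (expR 1 * (2 * K ^+ 2 * mgf_radius K)) <= 1.
Proof.
have k0 := sqr_ge0 K; have e0 := expR_gt0 (1 : R).
have -> : 2 * (expR 1 * (2 * K ^+ 2 * mgf_radius K)) = K ^+ 2 / (1 + K ^+ 2).
  by rewrite /mgf_radius; field; rewrite !gt_eqF//; lra.
by rewrite ler_pdivrMr; lra.
Qed.

End Constants.

Section GramDeviation.
Context (R : realType) (I T : finType) (n : nat).
Variables (Y : T -> 'I_n -> R) (K : R).
Hypothesis T0 : (0 < #|T|)%N.
Hypothesis Y_isotropic :
  forall i j, mean (fun s => Y s i * Y s j) = (i == j)%:R.
Hypothesis Y_moments : forall x, sqnorm x = 1 -> forall q : nat,
  mean (fun s => (\sum_i Y s i * x i) ^+ (2 * q)) <= (2 * K ^+ 2 * q%:R) ^+ q.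

Local Notation dot s x := (\sum_i Y s i * x i).

Lemma mean_sqr_dot x : mean (fun s => dot s x ^+ 2) = sqnorm x.
Proof.
rewrite (@eq_mean _ _ _ (fun s => \sum_i \sum_j x i * x j * (Y s i * Y s j))).
  rewrite mean_sum; apply: eq_bigr => i _.
  rewrite mean_sum (bigD1 i)//= big1 => [|j ji].
    by rewrite meanZ Y_isotropic eqxx mulr1 addr0 expr2.
  by rewrite meanZ Y_isotropic eq_sym (negbTE ji) mulr0.
move=> s; rewrite expr2 mulr_suml; apply: eq_bigr => i _; rewrite mulr_sumr.
by apply: eq_bigr => j _; ring.
Qed.

Lemma mean_expR_sqr_dot x l :
  sqnorm x = 1 -> 2 * `|l| <= mgf_radius K ->
  mean (fun s => expR (l * (dot s x ^+ 2 - 1))) <= expR (mgf_var K * l ^+ 2).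
Proof.
move=> x1 lK; apply: mean_expR_centred => //.
- exact: mgf_radius_gt0.
- by move=> s; exact: sqr_ge0.
- by rewrite mean_sqr_dot.
apply: (mean_expR_le2 (a := 2 * K ^+ 2)).
- by rewrite ltW ?mgf_radius_gt0.
- exact: mgf_radius_small.
- by move=> s; exact: sqr_ge0.
- move=> q; rewrite (@eq_mean _ _ _ (fun s => dot s x ^+ (2 * q))).
    exact: Y_moments.
  by move=> s; rewrite exprM.
- by rewrite mulr_ge0 ?sqr_ge0.
Qed.

(** The inequality is strict in the event, which is therefore empty for
    [x = 0]; otherwise [x] may be normalised. *)
Lemma freq_dot_dev x c : 0 < c <= 1 ->
  freq R [pred u : {ffun I -> T} |
      #|I|%:R * c * sqnorm x < `|\sum_l (dot (u l) x ^+ 2 - sqnorm x)|]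
    <= 2 * expR (- (#|I|%:R * c ^+ 2 / (4 * mgf_var K))).
Proof.
move=> /andP[c0 c1]; have [x0|x0] := eqVneq (sqnorm x) 0.
  apply: (@le_trans _ _ 0); last by rewrite mulr_ge0 ?expR_ge0.
  rewrite /freq (@eq_mean _ _ _ (fun=> 0)) => [|u].
    by rewrite /mean big1 ?mulr0.
  rewrite inE x0 mulr0 big1 ?normr0 ?ltxx// => l _.
  by rewrite subr0 big1 ?expr0n// => i _; rewrite (sqnorm_eq0 x0) mulr0.
have sx : 0 < sqnorm x by rewrite lt_neqAle eq_sym x0 sqnorm_ge0.
pose b := (Num.sqrt (sqnorm x))^-1.
have b2 : b ^+ 2 = (sqnorm x)^-1 by rewrite exprVn sqr_sqrtr// ltW.
pose z i := b * x i.
have z1 : sqnorm z = 1 by rewrite sqnormZ b2 mulVf.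
have dotz s : dot s x ^+ 2 - sqnorm x = sqnorm x * (dot s z ^+ 2 - 1).
  have -> : dot s z = b * dot s x.
    by rewrite mulr_sumr; apply: eq_bigr => i _; rewrite mulrCA.
  by rewrite exprMn b2; field.
apply: le_trans (freq_sum_dev (Z := fun s => dot s z ^+ 2 - 1) _ _ c0 _); last 2 first.
- exact: mgf_var_gt0.
- move=> l lc; apply: mean_expR_sqr_dot => //.
  have r0 := mgf_radius_gt0 K; have r1 := mgf_radius_le1 K.
  apply: (@le_trans _ _ (c * mgf_radius K ^+ 2 / 32)).
    apply: (@le_trans _ _ (2 * (c / (2 * mgf_var K)))); first by rewrite ler_wpM2l.
    rewrite le_eqVlt; apply/orP; left; apply/eqP; rewrite /mgf_var.
    by field; rewrite gt_eqF.
  have : c * mgf_radius K ^+ 2 <= mgf_radius K.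
    by rewrite expr2 mulrA ler_piMl ?mulr_ile1// ltW.
  lra.
apply: ler_freq => u; rewrite !inE => h.
rewrite (eq_bigr _ (fun l _ => dotz (u l))) -mulr_sumr normrM in h.
by move: h; rewrite gtr0_norm// mulrC ltr_pM2l// => /ltW.
Qed.

(** A union bound over the net; [qform_net] carries the estimate from the net to
    all vectors at the cost of a factor [5]. *)
Lemma gram_deviation (rho : R) : 0 < rho <= 1 ->
  exists2 E : {set {ffun I -> T}},
    freq R E <=
      16 ^+ n * (2 * expR (- (#|I|%:R * (rho / 5) ^+ 2 / (4 * mgf_var K)))) &
    forall u, u \notin E -> forall x,
      `|\sum_l dot (u l) x ^+ 2 - #|I|%:R * sqnorm x|
        <= #|I|%:R * rho * sqnorm x.
Proof.
move=> /andP[rho0 rho1].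
have c01 : 0 < rho / 5 <= 1 by apply/andP; split; lra.
have sumE (u : {ffun I -> T}) x : \sum_l (dot (u l) x ^+ 2 - sqnorm x) =
    \sum_l dot (u l) x ^+ 2 - #|I|%:R * sqnorm x.
  by rewrite big_split/= sumrN sumr_const -[sqnorm x *+ _]mulr_natl.
pose bad (w : lattice n) (u : {ffun I -> T}) := #|I|%:R * (rho / 5) * sqnorm (lvec R w)
  < `|\sum_l (dot (u l) (lvec R w) ^+ 2 - sqnorm (lvec R w))|.
exists [set u | [exists w in net n, bad w u]]%SET.
  apply: (@le_trans _ _ (#|net n|%:R *
      (2 * expR (- (#|I|%:R * (rho / 5) ^+ 2 / (4 * mgf_var K)))))).
    apply: le_trans (ler_freq (F := [pred u | [exists w in net n, bad w u]]) _ _) _.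
      by move=> u; rewrite !inE.
    apply: (freq_exists (E := fun w => [pred u | bad w u])) => w _.
    exact: freq_dot_dev.
  by rewrite ler_wpM2r ?mulr_ge0 ?expR_ge0 ?card_net.
move=> u; rewrite inE negb_exists => /forallP good x.
(* The deviation is the quadratic form of [M], the Gram matrix minus [#|I|] times
   the identity. *)
pose M : 'M[R]_n := \matrix_(i, j)
  (\sum_l Y (u l) i * Y (u l) j - (i == j)%:R * #|I|%:R).
have ME z : qform M z = \sum_l (dot (u l) z ^+ 2 - sqnorm z).
  rewrite sumE /qform.
  transitivity (\sum_i (\sum_j \sum_l Y (u l) i * Y (u l) j * z i * z j -
                        #|I|%:R * z i ^+ 2)).
    apply: eq_bigr => i _; rewrite (bigD1 i)//= [in RHS](bigD1 i)//= addrAC.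
    congr (_ + _).
      by rewrite mxE eqxx mul1r !mulrBl !mulr_suml expr2 mulrA.
    apply: eq_bigr => j ji.
    by rewrite mxE eq_sym (negbTE ji) mul0r subr0 !mulr_suml.
  rewrite sumrB -mulr_sumr; congr (_ - _).
  rewrite exchange_big /=.
  under eq_bigr do rewrite exchange_big /=.
  rewrite exchange_big /=; apply: eq_bigr => l _.
  rewrite expr2 mulr_suml exchange_big; apply: eq_bigr => i _; rewrite mulr_sumr.
  by apply: eq_bigr => j _; ring.
have := @qform_net R n M (#|I|%:R * (rho / 5)) _ _ x.
rewrite ME sumE => H; apply: le_trans (H _ _) _.
- by rewrite mulr_ge0//; lra.
- by move=> w wn; rewrite ME leNgt; have := good w; rewrite wn /bad.
by rewrite le_eqVlt; apply/orP; left; apply/eqP; field.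
Qed.

End GramDeviation.

(** The dimension term of the deviation pays for the size of the net, since
    [16 <= exp 16] and [1600 = 16 * 100]; what is left is the Gaussian tail. *)
Lemma net_union_bound (R : realType) (V t : R) (n r N : nat) :
  0 < V -> 0 <= t -> (0 < N)%N -> (n <= r + 1)%N ->
  forall rho,
  rho = 40 * Num.sqrt V * Num.sqrt ((r + 1)%:R / N%:R) + t / Num.sqrt N%:R ->
  16 ^+ n * (2 * expR (- (N%:R * (rho / 5) ^+ 2 / (4 * V))))
    <= 2 * expR (- ((100 * V)^-1 * t ^+ 2)).
Proof.
move=> V0 t0 N0 nr rho rhoE; have N0' : 0 < N%:R :> R by rewrite ltr0n.
rewrite mulrCA ler_pM2l//.
have rho2 : 1600 * V * (r + 1)%:R + t ^+ 2 <= N%:R * rho ^+ 2.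
  pose A := 40 * Num.sqrt V * Num.sqrt ((r + 1)%:R / N%:R).
  pose B := t / Num.sqrt N%:R.
  have A0 : 0 <= A by rewrite !mulr_ge0 ?sqrtr_ge0.
  have B0 : 0 <= B by rewrite divr_ge0 ?sqrtr_ge0.
  have A2 : N%:R * A ^+ 2 = 1600 * V * (r + 1)%:R.
    rewrite !exprMn !sqr_sqrtr ?divr_ge0 ?ltW//; field; exact: lt0r_neq0.
  have B2 : N%:R * B ^+ 2 = t ^+ 2.
    by rewrite exprMn exprVn sqr_sqrtr ?ltW// mulrCA mulfV ?mulr1// lt0r_neq0.
  rewrite -A2 -B2 -mulrDr ler_pM2l// rhoE -/A -/B.
  by have := mulr_ge0 A0 B0; rewrite sqrrD -mulr_natl; lra.
have e16 : 16 ^+ n <= expR ((r + 1)%:R * 16) :> R.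
  rewrite expRM_natl; apply: (@le_trans _ _ (16 ^+ (r + 1))).
    by rewrite ler_weXn2l// ler1n.
  by apply: lerXn2r; rewrite ?nnegrE ?expR_ge0//; have := @expR_ge1Dx R 16; lra.
apply: (@le_trans _ _ (expR ((r + 1)%:R * 16) *
    expR (- (N%:R * (rho / 5) ^+ 2 / (4 * V))))).
  by rewrite ler_wpM2r ?expR_ge0.
rewrite -expRD ler_expR.
have -> : N%:R * (rho / 5) ^+ 2 / (4 * V) = N%:R * rho ^+ 2 / (100 * V).
  by field; exact: lt0r_neq0.
have : (1600 * V * (r + 1)%:R + t ^+ 2) / (100 * V) <= N%:R * rho ^+ 2 / (100 * V).
  by rewrite ler_pM2r// invr_gt0 mulr_gt0.
have -> : (1600 * V * (r + 1)%:R + t ^+ 2) / (100 * V) =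
    (r + 1)%:R * 16 + (100 * V)^-1 * t ^+ 2 by field; exact: lt0r_neq0.
lra.
Qed.

(** * Rows of the Khatri-Rao matrix *)

Section Digits.
Context (d : nat) (k : 'I_d) (m : {i : 'I_d | i != k} -> nat).

(** Writing [a] in mixed radix, its class modulo the product of the radices of
    the digits from position [t] on is determined by these digits. *)
Lemma digit_inj (a b : 'I_(\prod_j m j)%N) :
  (forall i, digit i a = digit i b) -> a = b.
Proof.
move=> dab; pose W t := (\prod_(j : {i : 'I_d | i != k} | t <= val j) m j)%N.
suff modW s : (s <= d)%N -> a = b %[mod W (d - s)%N].
  apply: val_inj; have := modW d (leqnn d); rewrite subnn.
  have -> : W 0%N = (\prod_j m j)%N by apply: eq_bigl => j.
  by rewrite !modn_small.
elim: s => [_|s IH sd].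
  rewrite subn0 (_ : W d = 1%N) ?modn1// /W big_pred0// => j.
  by rewrite leqNgt ltn_ord.
have td : (d - s.+1 < d)%N by rewrite ltn_subrL (leq_ltn_trans _ sd).
have tS : (d - s)%N = (d - s.+1).+1 by rewrite subnSK.
have {}IH := IH (ltnW sd); rewrite tS in IH.
set t := (d - s.+1)%N in td IH *.
have [tk|tk] := eqVneq (Ordinal td) k.
  suff -> : W t = W t.+1 by [].
  apply: eq_bigl => j; rewrite leq_eqVlt orb_idl// => /eqP tj.
  have := valP j; have -> : val j = Ordinal td by apply: val_inj.
  by move=> /negP[]; apply/eqP.
pose j : {i : 'I_d | i != k} := exist _ (Ordinal td) tk.
have strideE : stride m j = W t.+1 by [].
have WE : W t = (m j * W t.+1)%N.
  rewrite /W (bigD1 j) ?leqnn//=; congr (_ * _)%N; apply: eq_bigl => i.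
  rewrite [in RHS]ltn_neqAle andbC; congr (_ && _).
  congr (~~ _); apply/eqP/eqP => [->//|ti].
  by do 2!apply: val_inj.
have := congr1 val (dab j); rewrite /= strideE => digE.
have splitE (c : nat) :
    (c %% W t = ((c %/ W t.+1) %% m j * W t.+1 + c %% W t.+1) %% W t)%N.
  rewrite {1}(divn_eq c (W t.+1)) {1}(divn_eq (c %/ W t.+1) (m j)).
  by rewrite mulnDl -addnA -mulnA -WE modnMDl.
by rewrite splitE digE IH -splitE.
Qed.

Context (R : realType).

Definition signb (c : bool) : R := if c then 1 else -1.

Lemma signb_inj : injective signb.
Proof. by case; case=> //; rewrite /signb; lra. Qed.

Lemma signb_sqr c : signb c * signb c = 1.
Proof. by case: c; rewrite /signb ?mulrNN mulr1. Qed.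

(** The entries of one column of each of the factors, as signs. *)
Definition signs : finType := {ffun {i & 'I_(m i)} -> bool}.

Lemma signs_gt0 : (0 < #|signs|)%N.
Proof. by rewrite card_ffun expn_gt0 card_bool. Qed.

Definition kr_entry (s : signs) (a : 'I_(\prod_j m j)%N) : R :=
  \prod_i signb (s (Tagged (fun i => 'I_(m i)) (digit i a))).

(** Different rows differ in some digit; changing the corresponding sign changes
    the sign of exactly one of the two entries. *)
Lemma mean_kr_entry a b :
  mean (fun s => kr_entry s a * kr_entry s b) = (a == b)%:R.
Proof.
case: eqP => [<-|ab].
  rewrite (@eq_mean _ _ _ (fun=> 1)) ?mean_cst ?signs_gt0// => s.
  by rewrite -big_split big1// => i _ /=; rewrite signb_sqr.
have [i dab] : exists i, digit i a != digit i b.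
  apply/existsP; apply: contra_notT ab => /existsPn h; apply: digit_inj => i.
  by have := h i; rewrite negbK => /eqP.
pose x := Tagged (fun i => 'I_(m i)) (digit i a).
pose flip (s : signs) : signs := [ffun y => s y (+) (y == x)].
apply: (mean_odd (s := flip)).
  by move=> s; apply/ffunP => y; rewrite !ffunE -addbA addbb addbF.
move=> s; have -> : kr_entry (flip s) b = kr_entry s b.
  apply: eq_bigr => j _; rewrite ffunE; case: eqP; rewrite ?addbF// => jx.
  case/eqP: dab; have ji : j = i by have /(congr1 tag) := jx.
  by subst j; move/eqP: jx; rewrite /x eq_Tagged /= => /eqP ->.
rewrite -mulNr; congr (_ * _).
rewrite /kr_entry (bigD1 i)//= [in RHS](bigD1 i)//= -mulNr; congr (_ * _).
  by rewrite ffunE eqxx addbT /signb; case: (s _) => //=; rewrite opprK.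
apply: eq_bigr => j ji; rewrite ffunE; case: eqP; rewrite ?addbF// => jx.
by case/eqP: ji; have /(congr1 tag) := jx.
Qed.

Context (n : nat) (Q : 'M[R]_((\prod_j m j)%N, n)).

(** One row of the sketch [R^T Q], as a function of the signs of one column. *)
Definition kr_row (s : signs) (j : 'I_n) : R := \sum_a kr_entry s a * Q a j.

Lemma mean_kr_row i j :
  Q^T *m Q = 1%:M -> mean (fun s => kr_row s i * kr_row s j) = (i == j)%:R.
Proof.
move=> Qo.
rewrite (@eq_mean _ _ _ (fun s => \sum_a \sum_b
    (Q a i * Q b j) * (kr_entry s a * kr_entry s b))).
  rewrite mean_sum; transitivity ((Q^T *m Q) i j); last by rewrite Qo mxE.
  rewrite mxE; apply: eq_bigr => a _; rewrite mean_sum (bigD1 a)//=.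
  rewrite [X in _ + X]big1 => [|b ba].
    by rewrite meanZ mean_kr_entry eqxx mulr1 addr0 mxE.
  by rewrite meanZ mean_kr_entry eq_sym (negbTE ba) mulr0.
move=> s; rewrite mulr_suml; apply: eq_bigr => a _; rewrite mulr_sumr.
by apply: eq_bigr => b _; ring.
Qed.

End Digits.

(** * Uniformly distributed maps to finite types *)

Section Uniform.
Context (disp : measure_display) (Omega : measurableType disp) (R : realType)
        (P : probability Omega R) (U : finType) (f : Omega -> U).

Definition uniform_map : Prop :=
  (forall u, measurable (f @^-1` [set u])) /\
  exists c : R, forall u, P (f @^-1` [set u]) = c%:E.

Hypothesis f_unif : uniform_map.

Lemma integral_uniform_map (F : U -> R) :
  (forall u, 0 <= F u) -> (\int[P]_w (F (f w))%:E = (mean F)%:E)%E.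
Proof.
case: f_unif => mf [c Pc] F0.
have int (G : U -> R) : (forall u, 0 <= G u) ->
    (\int[P]_w (G (f w))%:E = (\sum_u G u * c)%:E)%E.
  move=> G0.
  transitivity (\int[P]_w (\sum_u (G u * \1_(f @^-1` [set u]) w)%:E))%E.
    apply: eq_integral => w _; rewrite sumEFin (bigD1 (f w))//= big1 => [|u uf].
      by rewrite indicE mem_set// mulr1 addr0.
    by rewrite indicE memNset ?mulr0//= => /esym/eqP; rewrite (negbTE uf).
  rewrite ge0_integral_sum//.
  - rewrite -sumEFin; apply: eq_bigr => u _.
    under eq_integral do rewrite EFinM.
    rewrite ge0_integralZl_EFin//.
    + by rewrite integral_indic// setIT EFinM -(Pc u).
    + apply/measurable_EFinP; exact: measurable_indic.
  - move=> u; apply/measurable_EFinP/measurable_funM => //.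
  - by move=> u w _; rewrite lee_fin mulr_ge0.
(* The total mass is [1], so the common mass [c] is the inverse of [#|U|]. *)
have c1 : \sum_(u : U) c = 1.
  have : (\sum_(u : U) 1 * c)%:E = 1%E.
    rewrite -(int (fun=> 1))// integral_cst// mul1e; exact: probability_setT.
  by under eq_bigr do rewrite mul1r; case.
rewrite int// /mean -mulr_suml; congr _%:E; rewrite mulrC; congr (_ * _).
have {}c1 : #|U|%:R * c = 1 by rewrite mulr_natl -sumr_const.
have U0 : #|U|%:R != 0 :> R.
  by apply/eqP => U0; move: c1; rewrite U0 mul0r => /esym/eqP; rewrite oner_eq0.
by apply: (mulfI U0); rewrite divff.
Qed.

Lemma measurable_uniform_map (E : set U) : measurable (f @^-1` E).
Proof.
case: f_unif => mf _.
rewrite (_ : f @^-1` _ = \bigcup_(u in E) (f @^-1` [set u])).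
  by apply: fin_bigcup_measurable => // u _; exact: mf.
by rewrite -preimage_bigcup bigcup_imset1 image_id.
Qed.

Lemma prob_uniform_map (E : {set U}) : P (f @^-1` [set` E]) = (freq R E)%:E.
Proof.
rewrite -(integral_uniform_map (F := fun u => (u \in E)%:R))//.
transitivity (\int[P]_w (\1_(f @^-1` [set` E]) w)%:E)%E.
  rewrite integral_indic ?setIT//; exact: measurable_uniform_map.
by apply: eq_integral => w _; rewrite indicE; congr (_%:R%:E); rewrite mem_setE.
Qed.

(** The supremum that defines the norm is at least its member at [p = 2 q],
    where the absolute value in the moment disappears. *)
Lemma psi2_moments (F : U -> R) (K : R) (q : nat) :
  0 <= K -> (psi2 P (F \o f) <= K%:E)%E ->
  mean (fun u => F u ^+ (2 * q)) <= (2 * K ^+ 2 * q%:R) ^+ q.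
Proof.
move=> K0 psiK; case: q => [|q].
  rewrite expr0 /mean (eq_bigr (fun=> 1)) => [|u _]; last by rewrite muln0 expr0.
  rewrite sumr_const; have [->|U0] := eqVneq #|U| 0%N; first by rewrite mulr0.
  by rewrite mulVf// pnatr_eq0.
set p : R := (2 * q.+1)%:R.
have p1 : 1 <= p by rewrite ler1n.
have p0 : 0 < p by rewrite (lt_le_trans ltr01).
set mu := mean _.
have mu0 : 0 <= mu.
  by apply: mean_ge0 => u; rewrite exprM exprn_ge0// sqr_ge0.
have normE : ('N[P]_(p%:E)[EFin \o (F \o f)])%E = (mu `^ p^-1)%:E.
  rewrite unlock -poweR_EFin -integral_uniform_map => [|u]; last first.
    by rewrite exprM exprn_ge0// sqr_ge0.
  congr (_ `^ _)%E; apply: eq_integral => w _ /=.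
  rewrite powR_mulrn// -normrX ger0_norm// exprM exprn_ge0// sqr_ge0.
  done.
have muK : p `^ (- 2^-1) * mu `^ p^-1 <= K.
  rewrite -lee_fin EFinM -normE; apply: le_trans psiK.
  by apply: ereal_sup_ubound; exists p.
have {}muK : mu `^ p^-1 <= K * p `^ 2^-1.
  by move: muK; rewrite powRN mulrC ler_pdivrMr// powR_gt0.
have -> : mu = (mu `^ p^-1) ^+ (2 * q.+1).
  by rewrite -powR_mulrn ?powR_ge0// -powRrM mulVf ?gt_eqF// powRr1.
apply: le_trans (_ : (K * p `^ 2^-1) ^+ (2 * q.+1) <= _).
  by apply: lerXn2r; rewrite ?nnegrE ?mulr_ge0 ?powR_ge0.
have p0' := ltW p0.
suff -> : (K * p `^ 2^-1) ^+ (2 * q.+1) = (2 * K ^+ 2 * q.+1%:R) ^+ q.+1 by [].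
rewrite exprM; congr (_ ^+ _).
rewrite powR12_sqrt// exprMn sqr_sqrtr// /p natrM; ring.
Qed.

End Uniform.

(** * The pattern of signs of the random matrix *)

Section SignPattern.
Context (d : nat) (k : 'I_d) (m : {i : 'I_d | i != k} -> nat) (n : nat)
  (disp : measure_display) (Omega : measurableType disp) (R : realType)
  (P : probability Omega R)
  (X : forall i : {i : 'I_d | i != k}, 'I_(m i) -> 'I_n -> {RV P >-> R}).
Arguments X : clear implicits.

Hypothesis X_rademacher : forall i a l, rademacher (X i a l).
Arguments X_rademacher : clear implicits.

Definition sign_pattern (w : Omega) : {ffun 'I_n -> signs m} :=
  [ffun l => [ffun s => X (tag s) (tagged s) l w == 1]].

Lemma signb_pattern i a l w :
  X i a l w = signb R (sign_pattern w l (Tagged (fun i => 'I_(m i)) a)).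
Proof.
rewrite !ffunE /=; case: (X_rademacher i a l) => /(_ w)[] -> _ _.
  by rewrite eqxx.
by rewrite /signb lt_eqF//; lra.
Qed.

Definition kr_matrix (u : {ffun 'I_n -> signs m}) : 'M[R]_((\prod_j m j)%N, n) :=
  \matrix_(a, l) kr_entry R (u l) a.

Lemma random_khatri_raoE :
  random_khatri_rao X = fun w => kr_matrix (sign_pattern w).
Proof.
apply/funext => w; apply/matrixP => a l; rewrite !mxE.
by apply: eq_bigr => i _; rewrite !mxE signb_pattern.
Qed.

Lemma sign_pattern_uniform :
  mutually_independent
    (fun s : {i : {i : 'I_d | i != k} & ('I_(m i) * 'I_n)%type} =>
       X (tag s) (tagged s).1 (tagged s).2) ->
  uniform_map P sign_pattern.
Proof.
move=> indep.
pose I : finType := {i : {i : 'I_d | i != k} & ('I_(m i) * 'I_n)%type}.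
pose XI (s : I) := X (tag s) (tagged s).1 (tagged s).2.
pose B (u : {ffun 'I_n -> signs m}) (s : I) : set R :=
  [set signb R (u (tagged s).2 (Tagged (fun i => 'I_(m i)) (tagged s).1))].
have preE u : sign_pattern @^-1` [set u] =
    [set w | forall s, s \in [set: I]%SET -> B u s (XI s w)].
  apply/seteqP; split => w /= => [<- s _|h].
    by rewrite /B /XI /= signb_pattern.
  apply/ffunP => l; apply/ffunP => -[i a].
  have := h (Tagged (fun i => ('I_(m i) * 'I_n)%type) (a, l)) (finset.in_setT _).
  by rewrite /B /XI /= signb_pattern => /signb_inj.
split=> [u|].
  rewrite preE (_ : [set w | _] = \bigcap_(s in [set: I]) (XI s @^-1` B u s)).
    apply: fin_bigcap_measurable => // s _.
    by apply: (measurable_funPTI (XI s)); exact: measurable_set1.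
  by apply/seteqP; split => w h s _; apply: h => //; rewrite finset.in_setT.
exists (\prod_(s in [set: I]%SET) 2^-1) => u.
rewrite preE indep => [|s]; last exact: measurable_set1.
rewrite -prodEFin; apply: eq_bigr => s _; rewrite /B.
by case: (X_rademacher (tag s) (tagged s).1 (tagged s).2) => _ h1 h2; case: (u _ _).
Qed.

Context (r : nat) (Q : 'M[R]_((\prod_j m j)%N, r)).

Lemma sketch_coord u (v : 'cV[R]_r) l :
  ((kr_matrix u)^T *m Q *m v) l 0 = \sum_j kr_row Q (u l) j * v j 0.
Proof.
rewrite mxE; apply: eq_bigr => j _; rewrite mxE; congr (_ * _).
by apply: eq_bigr => a _; rewrite !mxE.
Qed.

(** The columns all have the same distribution, so the bound on any one of them
    gives the moments of a generic row of the sketch. *)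
Lemma kr_row_moments (K : R) (l : 'I_n) :
  uniform_map P sign_pattern -> 0 <= K ->
  (psi2_vec P (fun w => (col l (random_khatri_rao X w))^T *m Q) <= K%:E)%E ->
  forall x : 'I_r -> R, sqnorm x = 1 -> forall q : nat,
  mean (fun s => (\sum_j kr_row Q s j * x j) ^+ (2 * q))
    <= (2 * K ^+ 2 * q%:R) ^+ q.
Proof.
move=> unif K0 psiK x x1 q.
pose F u := \sum_j kr_row Q (u l) j * x j.
have := mean_coord l (fun s => (\sum_j kr_row Q s j * x j) ^+ (2 * q)) (signs_gt0 m).
move=> <-; apply: (psi2_moments unif (F := F)) => //; apply: le_trans psiK.
apply: ereal_sup_ubound; exists (\col_j x j).
  rewrite /l2norm /= (_ : \sum_i _ = 1) ?sqrtr1// -[RHS]x1.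
  by apply: eq_bigr => i _; rewrite mxE.
congr psi2; apply/funext => w; rewrite random_khatri_raoE tr_col -!row_mul.
by rewrite mxE sketch_coord; apply: eq_bigr => j _; rewrite mxE.
Qed.

End SignPattern.

(** * Least squares after a near-isometric sketch *)

Section Sketch.
Context (R : realType).

Lemma l2normE n (v : 'cV[R]_n) : l2norm v = Num.sqrt (sqnorm (fun i => v i 0)).
Proof. by []. Qed.

Lemma sqnorm_mx n (v : 'cV[R]_n) : sqnorm (fun i => v i 0) = (v^T *m v) 0 0.
Proof. by rewrite mxE; apply: eq_bigr => i _; rewrite mxE expr2. Qed.

Lemma gram_unitmx N n (B : 'M[R]_(N, n)) :
  (forall v : 'cV[R]_n, sqnorm (fun i => (B *m v) i 0) = 0 -> v = 0) ->
  B^T *m B \in unitmx.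
Proof.
move=> inj; rewrite unitmxE unitfE; apply/det0P => -[v v0 vB].
case/eqP: v0; apply: trmx_inj; rewrite trmx0; apply: inj.
by rewrite sqnorm_mx trmx_mul trmxK -mulmxA (mulmxA B^T) mulmxA vB mul0mx mxE.
Qed.

(** Residuals [A x - b] lie in the range of [Q], where the sketch distorts squared
    lengths by at most [1 - rho] and [1 + rho]; comparing the sketched residuals
    gives the square root of the stated factor, which is at least [1]. *)
Lemma sketched_lsq M r n N (A : 'M[R]_(M, r)) (b : 'cV[R]_M) (Q : 'M[R]_(M, n))
    (T : 'M[R]_(n, r + 1)) (S : 'M[R]_(M, N)) (x y : 'cV[R]_r) (rho : R) :
  Q^T *m Q = 1%:M -> row_mx A b = Q *m T -> (0 < N)%N -> 0 < rho < 1 ->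
  (forall v : 'cV[R]_n,
    `|sqnorm (fun i => (S^T *m Q *m v) i 0) - N%:R * sqnorm (fun i => v i 0)|
      <= N%:R * rho * sqnorm (fun i => v i 0)) ->
  lsq_solution (S^T *m A) (S^T *m b) x ->
  l2norm (A *m x - b) <= (1 + rho) / (1 - rho) * l2norm (A *m y - b).
Proof.
move=> QQ AQ N0 /andP[rho0 rho1] iso lsq.
pose c (z : 'cV[R]_r) : 'cV[R]_n := T *m col_mx z (- 1%:M).
have resE z : A *m z - b = Q *m c z.
  by rewrite mulmxA -AQ mul_row_col mulmxN mulmx1.
have Qnorm (v : 'cV[R]_n) : sqnorm (fun i => (Q *m v) i 0) = sqnorm (fun i => v i 0).
  by rewrite !sqnorm_mx trmx_mul -mulmxA (mulmxA Q^T) QQ mul1mx.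
have SresE z : S^T *m A *m z - S^T *m b = S^T *m Q *m c z.
  by rewrite -!mulmxA -mulmxBr resE.
have := lsq y; rewrite !SresE !l2normE ler_sqrt ?sqnorm_ge0// => le.
have := iso (c x); have := iso (c y); rewrite !ler_norml => /andP[_ hy] /andP[hx _].
rewrite !resE !Qnorm; move: (sqnorm_ge0 (fun i => c y i 0)) hx hy le.
move: (sqnorm (fun i => c x i 0)) (sqnorm (fun i => c y i 0)) => sx sy sy0 hx hy le.
have NR : 0 < N%:R :> R by rewrite ltr0n.
have d0 : 0 < 1 - rho by lra.
set q := (1 + rho) / (1 - rho).
have q1 : 1 <= q by rewrite ler_pdivlMr//; lra.
have sxy : sx <= q * sy.
  rewrite /q mulrAC ler_pdivlMr// -(ler_pM2l NR); lra.
rewrite -(ger0_norm (le_trans ler01 q1)) -sqrtr_sqr -sqrtrM ?sqr_ge0//.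
rewrite ler_wsqrtr//; apply: le_trans sxy _.
by rewrite ler_wpM2r// expr2 ler_peMl// (le_trans ler01).
Qed.

End Sketch.

(** * Accuracy of the sketched solution *)

Theorem theorem12 (Re : realType) :
  exists C c : Re -> Re,
    (forall K : Re, 0 < C K /\ 0 < c K) /\
    forall (d : nat) (k : 'I_d) (m : {i : 'I_d | i != k} -> nat)
      (r r' rQ : nat)
      (disp : measure_display) (Omega : measurableType disp)
      (P : probability Omega Re)
      (X : forall i : {i : 'I_d | i != k},
             'I_(m i) -> 'I_r' -> {RV P >-> Re})
      (A : 'M[Re]_((\prod_j m j)%N, r)) (b : 'cV[Re]_(\prod_j m j)%N)
      (Q : 'M[Re]_((\prod_j m j)%N, rQ)) (T : 'M[Re]_(rQ, r + 1))
      (y : 'cV[Re]_r) (K t : Re),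
    let R := random_khatri_rao X in
    let full_rank :=
      [set w | ((R w)^T *m Q)^T *m ((R w)^T *m Q) \in unitmx] in
    let rho := C K * Num.sqrt ((r + 1)%:R / r'%:R) + t / Num.sqrt r'%:R in
    let good :=
      [set w | forall x : 'cV[Re]_r,
         lsq_solution ((R w)^T *m A) ((R w)^T *m b) x ->
         l2norm (A *m x - b) <= (1 + rho) / (1 - rho) * l2norm (A *m y - b)] in
    (2 <= d)%N ->
    (forall i, (0 < m i)%N) ->
    (forall i a l, rademacher (X i a l)) ->
    mutually_independent
      (fun s : {i : {i : 'I_d | i != k} & ('I_(m i) * 'I_r')%type} =>
         X (tag s) (tagged s).1 (tagged s).2) ->
    (0 < r')%N -> (r <= r')%N -> (r' <= \prod_j m j)%N ->
    lsq_solution A b y ->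
    (rQ <= r + 1)%N ->
    Q^T *m Q = 1%:M ->
    row_mx A b = Q *m T ->
    K%:E = \big[maxe/0%E]_(l < r') psi2_vec P (fun w => (col l (R w))^T *m Q) ->
    0 <= t ->
    rho < 1 ->
    ((1 - 2 * expR (- (c K * t ^+ 2)))%:E * P full_rank
       <= P (full_rank `&` good))%E.
Proof.
(* These are the constants for which the size of the net is paid for in
   [net_union_bound]. *)
exists (fun K => 40 * Num.sqrt (mgf_var K)), (fun K => (100 * mgf_var K)^-1).
split=> [K|].
  have V0 := mgf_var_gt0 K.
  by rewrite invr_gt0; split; rewrite mulr_gt0 ?sqrtr_gt0.
move=> d k m r r' rQ disp Omega P X A b Q T y K t R full_rank rho good.
move=> _ _ Xrad Xind r'0 _ _ _ rQr QQ AQ KE t0 rho1.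
have V0 := mgf_var_gt0 K.
have unif := sign_pattern_uniform Xrad Xind.
have K0 : 0 <= K.
  rewrite -lee_fin KE; exact: bigmax_ge_id.
have psiK (l : 'I_r') : (psi2_vec P (fun w => (col l (R w))^T *m Q) <= K%:E)%E.
  by rewrite KE; exact: le_bigmax.
have rho0 : 0 < rho.
  rewrite ltr_pwDl ?divr_ge0 ?sqrtr_ge0// !mulr_gt0 ?sqrtr_gt0//.
  by rewrite divr_gt0 ?ltr0n// addn1.
have [E freqE dev] : exists2 E : {set {ffun 'I_r' -> signs m}},
    freq Re E <= 2 * expR (- ((100 * mgf_var K)^-1 * t ^+ 2)) &
    forall u, u \notin E -> forall v : 'cV[Re]_rQ,
      `|sqnorm (fun i => ((kr_matrix Re u)^T *m Q *m v) i 0) -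
        r'%:R * sqnorm (fun i => v i 0)| <= r'%:R * rho * sqnorm (fun i => v i 0).
  have rho01 : 0 < rho <= 1 by rewrite rho0 ltW.
  have [E] := gram_deviation 'I_r' (signs_gt0 m)
    (fun i j => mean_kr_row i j QQ)
    (kr_row_moments Xrad unif K0 (psiK (Ordinal r'0))) rho01.
  rewrite card_ord => fE dev; exists E.
    by apply: (le_trans fE); exact: (net_union_bound V0 t0 r'0 rQr erefl).
  move=> u /dev /(_ _) devu v; have := devu (fun i => v i 0).
  rewrite (_ : \sum_l _ = sqnorm (fun i => ((kr_matrix Re u)^T *m Q *m v) i 0))//.
  by apply: eq_bigr => l _; rewrite sketch_coord.
pose f := sign_pattern X.
have RE w : R w = kr_matrix Re (f w) by rewrite /R (random_khatri_raoE Xrad).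
(* Near-isometry with [rho < 1] also forces full rank. *)
have goodE : ~` (f @^-1` [set` E]) `<=` full_rank `&` good.
  move=> w /= /negP /dev iso; split.
    apply: gram_unitmx => v; rewrite RE => v0.
    have := iso v; rewrite v0 sub0r normrN ger0_norm ?mulr_ge0 ?sqnorm_ge0//.
    move=> h; apply/colP => i; rewrite mxE.
    apply: (sqnorm_eq0 (x := fun i => v i 0)); apply/eqP.
    rewrite eq_le sqnorm_ge0 andbT leNgt; apply/negP => s0.
    by move: h; rewrite ler_pM2r// ler_pMr ?ltr0n// leNgt rho1.
  move=> x; rewrite RE; apply: sketched_lsq QQ AQ r'0 _ iso.
  by rewrite rho0.
have mfull : measurable full_rank.
  rewrite (_ : full_rank = f @^-1` [set u |
    ((kr_matrix Re u)^T *m Q)^T *m ((kr_matrix Re u)^T *m Q) \in unitmx]).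
    exact: (measurable_uniform_map unif).
  by apply/seteqP; split => w; rewrite /full_rank /= RE.
have mgood : measurable good.
  rewrite (_ : good = f @^-1` [set u | forall x : 'cV[Re]_r,
      lsq_solution ((kr_matrix Re u)^T *m A) ((kr_matrix Re u)^T *m b) x ->
      l2norm (A *m x - b) <= (1 + rho) / (1 - rho) * l2norm (A *m y - b)]).
    exact: (measurable_uniform_map unif).
  by apply/seteqP; split => w; rewrite /good /= RE.
set q := 2 * expR _ in freqE *.
(* For [q >= 1] the left-hand side is not positive; otherwise it is at most
   [1 - q], whatever the probability of full rank. *)
have [q1|q1] := leP 1 q.
  apply: (@le_trans _ _ 0%E); last exact: measure_ge0.
  by apply: mule_le0_ge0; rewrite ?lee_fin ?subr_le0// measure_ge0.
apply: (@le_trans _ _ (1 - q)%:E).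
  rewrite -[leRHS]mule1 lee_wpmul2l ?lee_fin ?subr_ge0 ?(ltW q1)//.
  exact: probability_le1.
apply: (@le_trans _ _ (P (~` (f @^-1` [set` E])))).
  rewrite probability_setC; last exact: (measurable_uniform_map unif).
  by rewrite (prob_uniform_map unif) -EFinB lee_fin lerB.
apply: le_measure => //; rewrite inE; last exact: measurableI.
by apply: measurableC; exact: (measurable_uniform_map unif).
Qed.
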